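(* Let $s\in\{0,\dots,r\}$ and let $\mathcal{S}$ be an embedded submanifold of $\mathbb{R}^{m\times n}_s$. Then $\varphi^{-1}(\mathcal{S})$ is an embedded submanifold of $\mathcal{M}$ of dimension $\dim\mathcal{S}+(n-r)(r-s)$. If $\mathcal{S}$ is $C^k$ for some $k$, then $\varphi^{-1}(\mathcal{S})$ is also $C^k$. Moreover, for every $(X,P)\in\varphi^{-1}(\mathcal{S})$, the tangent space is $$\mathrm{T}_{(X,P)}\varphi^{-1}(\mathcal{S})=\big\{(\dot X,\dot P)\in\mathrm{T}_{(X,P)}\mathcal{M} : \dot X\in\mathrm{T}_X\mathcal{S}\big\}.$$
   Context: Let $m,n,r$ be positive integers with $r<\min(m,n)$. Let $\mathrm{Sym}(n)$ be the space of real symmetric $n\times n$ matrices and $\mathrm{Gr}(n,n-r)=\{P\in\mathrm{Sym}(n): P^2=P,\ \mathrm{rank}\,P=n-r\}$. Let $\mathbb{R}^{m\times n}_s$ be the set (smooth embedded submanifold of $\mathbb{R}^{m\times n}$ of dimension $(m+n-s)s$) of real $m\times n$ matrices of rank exactly $s$. The desingularization $\mathcal{M}=\{(X,P)\in\mathbb{R}^{m\times n}\times\mathrm{Gr}(n,n-r): XP=0\}$ is a smooth embedded submanifold of $\mathbb{R}^{m\times n}\times\mathrm{Sym}(n)$ of dimension $(m+n-r)r$. The map $\varphi\colon\mathcal{M}\to\mathbb{R}^{m\times n}$ is $\varphi(X,P)=X$. *)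

(* Defs.v *)
From HB Require Import structures.
From mathcomp Require Import all_boot all_order all_algebra.
From mathcomp Require Import all_classical all_reals all_analysis.

Set Implicit Arguments.
Unset Strict Implicit.
Unset Printing Implicit Defensive.

Import Order.TTheory GRing.Theory Num.Theory.
Import numFieldNormedType.Exports.

Local Open Scope classical_set_scope.
Local Open Scope ring_scope.

(* Meant for an open set U of a finite-dimensional space V: there, asking that
   x |-> 'd f x v be C^j for each fixed v is the same as asking that
   x |-> 'd f x be C^j for the operator norm. *)
Fixpoint is_Cn (R : realType) (V W : normedModType R) (j : nat)
    (U : set V) (f : V -> W) : Prop :=
  if j is i.+1 then
    (forall x, U x -> differentiable f x) /\
    (forall v : V, is_Cn i U (fun x : V => 'd f x v))
  else forall x, U x -> {for x, continuous f}.

(* A regularity class is [Some k] for C^k and [None] for C^oo. *)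
Definition is_Ck (R : realType) (V W : normedModType R) (k : option nat)
    (U : set V) (f : V -> W) : Prop :=
  if k is Some j then is_Cn j U f else forall j, is_Cn j U f.

(* R^d x {0} inside R^D *)
Definition coord_slice (R : realType) (D d : nat) : set 'rV[R]_D :=
  [set y | forall i : 'I_D, (d <= i)%N -> y 0 i = 0].
Arguments coord_slice : clear implicits.

(* Near x, the set M embedded in the Euclidean space E carries the chart
   f : U `&` M -> V, with V open in R^D and inverse g; regularity of f on the
   subset U `&` M means that f is the restriction of a C^k map on U.  The
   chart is adapted to N: it maps U `&` N onto V `&` (R^d x {0}). *)
Definition slice_chart_at (R : realType) (E : normedModType R)
    (k : option nat) (M : set E) (D : nat) (N : set E) (d : nat) (x : E)
    : Prop :=
  exists (U : set E) (V : set 'rV[R]_D) (f : E -> 'rV[R]_D) (g : 'rV[R]_D -> E),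
    [/\ open U /\ U x,
        open V,
        is_Ck k U f /\ is_Ck k V g,
        g @` V = U `&` M /\ (forall y, V y -> f (g y) = y) &
        g @` (V `&` coord_slice R D d) = U `&` N].

(* N is a d-dimensional embedded submanifold, of class C^k, of the
   D-dimensional submanifold M of E. *)
Definition embedded_submanifold (R : realType) (E : normedModType R)
    (k : option nat) (M : set E) (D : nat) (N : set E) (d : nat) : Prop :=
  [/\ N `<=` M,
      (d <= D)%N &
      forall x, N x -> slice_chart_at k M D N d x].

(* Velocities at x of the C^1 curves contained in M. *)
Definition tangent_space (R : realType) (E : normedModType R)
    (M : set E) (x : E) : set E :=
  [set v | exists (c : R -> E) (e : R),
    [/\ 0 < e,
        is_Ck (Some 1%N) [set t : R | `|t| < e] c,
        forall t : R, `|t| < e -> M (c t),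
        c 0 = x &
        derive1 c 0 = v]].

Definition fixed_rank (R : realType) (m n s : nat) : set 'M[R]_(m, n) :=
  [set X | \rank X = s].
Arguments fixed_rank : clear implicits.

Definition Sym (R : realType) (n : nat) : set 'M[R]_n :=
  [set P | P^T = P].
Arguments Sym : clear implicits.

(* Gr n p is Gr(n, p): orthogonal projectors of rank p *)
Definition Gr (R : realType) (n p : nat) : set 'M[R]_n :=
  [set P | [/\ Sym R n P, P *m P = P & \rank P = p]].
Arguments Gr : clear implicits.

(* The ambient space R^(m x n) x Sym(n) is seen as a linear subspace of
   'M_(m, n) * 'M_n. *)
Definition desing (R : realType) (m n r : nat)
    : set ('M[R]_(m, n) * 'M[R]_n)%type :=
  [set Z | Gr R n (n - r)%N Z.2 /\ Z.1 *m Z.2 = 0].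
Arguments desing : clear implicits.

Definition phi (R : realType) (m n : nat)
    (Z : ('M[R]_(m, n) * 'M[R]_n)%type) : 'M[R]_(m, n) := Z.1.

Definition phi_preimage (R : realType) (m n r : nat) (S : set 'M[R]_(m, n))
    : set ('M[R]_(m, n) * 'M[R]_n)%type :=
  desing R m n r `&` @phi R m n @^-1` S.

(* Main.v *)
(* Near a point (X0, P0) of the desingularization with rank X0 = s, pick block
   coordinates in which X = [A, B; C, D] with A invertible of size s.  Then
   X = [A, B; C, C A^-1 B] + E, and the row space of 1 - P is spanned by
   [I, A^-1 B] together with rows of the form [0, I, W]; moreover X P = 0 forces
   E = [0; Z] [0, I, W].  Thus (X, P) is equivalent to (Y, Z, W), where
   Y = [A, B; C, C A^-1 B] ranges over the matrices of rank s, the matrices Z and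
   W are free, and rank X = s iff Z = 0, in which case X = Y.  A chart of the
   matrices of rank s adapted to S hence yields one of the desingularization
   adapted to phi^-1(S).  The tangent space follows by applying the smooth map
   (X, P) |-> (Y, Z, W) |-> (X, P), which retracts onto the desingularization,
   to the pair made of a curve in S and of the P-component of a curve in the
   desingularization. *)

Require Import Defs.
From HB Require Import structures.
From mathcomp Require Import all_boot all_order all_algebra.
From mathcomp Require Import all_classical all_reals all_analysis.
From mathcomp Require Import zify.

Set Implicit Arguments.
Unset Strict Implicit.
Unset Printing Implicit Defensive.

Import Order.TTheory GRing.Theory Num.Theory.
Import numFieldNormedType.Exports.

Local Open Scope classical_set_scope.
Local Open Scope ring_scope.

(** * Differential calculus of C^k maps *)

(** The first-order expansion at [x] only involves values near [x], so it passes from [f] to [g].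
    This is what makes ['d], and then [is_Cn] on an open set, local notions. *)
Lemma near_eq_diff_locally (R : realType) (V W : normedModType R)
    (f g : V -> W) (x : V) :
  {near x, f =1 g} -> differentiable f x ->
  g \o shift x = cst (g x) + 'd f x +o_ 0 id.
Proof.
move=> fg /diff_locally dfx.
apply/eqaddoP => e e0; move/eqaddoP : dfx => /(_ e e0) dfx.
have fgx := nbhs_singleton fg.
have fg0 : \forall h \near 0, f (h + x) = g (h + x).
  have := fg; rewrite (near_shift 0 x); apply: filterS => h /=.
  by rewrite subr0.
near=> h.
have : f (h + x) = g (h + x) by near: h.
have : `|(f \o shift x - (cst (f x) + 'd f x)) h| <= e * `|id h|.
  by near: h.
rewrite !fctE /= => + E; by rewrite E fgx.
Unshelve. all: by end_near. Qed.

Lemma near_eq_diff (R : realType) (V W : normedModType R)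
    (f g : V -> W) (x : V) :
  {near x, f =1 g} -> differentiable f x ->
  'd g x = 'd f x :> (V -> W).
Proof.
move=> fg df; apply: diff_unique; first exact: diff_continuous.
exact: near_eq_diff_locally.
Qed.

Lemma near_eq_differentiable (R : realType) (V W : normedModType R)
    (f g : V -> W) (x : V) :
  {near x, f =1 g} -> differentiable f x -> differentiable g x.
Proof.
move=> fg df; apply/diff_locallyP; rewrite (near_eq_diff fg df); split.
  exact: diff_continuous.
exact: near_eq_diff_locally.
Qed.

Section RegularMaps.
Context {R : realType}.
Implicit Types V W Y : normedModType R.

Lemma near_eq_open V W (U : set V) (f g : V -> W) x :
  open U -> (forall x, U x -> f x = g x) -> U x -> {near x, f =1 g}.
Proof.
move=> oU fg Ux.
by have := open_nbhs_nbhs (conj oU Ux); apply: filterS => y /fg.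
Qed.

(** The calculus rules for ['d] hold only where the maps are differentiable, so a derivative is
    known to equal its formula on [U] alone; the inductions below use this lemma to replace one by
    the other. *)
Lemma is_Cn_eq V W j (U : set V) (f g : V -> W) :
  open U -> (forall x, U x -> f x = g x) -> is_Cn j U f -> is_Cn j U g.
Proof.
move=> oU; elim: j f g => [|j IH] f g fg /=.
  move=> cf x Ux; have nfg := near_eq_open oU fg Ux.
  rewrite /prop_for /continuous_at -(fg _ Ux).
  exact: cvg_trans (near_eq_cvg nfg) (cf x Ux).
move=> [df dfv]; split=> [x Ux|v].
  exact: near_eq_differentiable (near_eq_open oU fg Ux) (df _ Ux).
apply: IH (dfv v) => x Ux.
exact/esym/(congr1 (@^~ v) (near_eq_diff (near_eq_open oU fg Ux) (df _ Ux))).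
Qed.

Lemma is_Cn_subset V W j (U U' : set V) (f : V -> W) :
  U' `<=` U -> is_Cn j U f -> is_Cn j U' f.
Proof.
move=> UU'; elim: j f => [|j IH] f /=; first by move=> cf x /UU'; apply: cf.
by move=> [df dfv]; split=> [x /UU'|v]; [apply: df|apply: IH].
Qed.

Lemma is_CnW V W j (U : set V) (f : V -> W) : is_Cn j.+1 U f -> is_Cn j U f.
Proof.
elim: j f => [|j IH] f.
  by move=> [df _] x Ux; apply: differentiable_continuous; apply: df.
by move=> [df dfv]; split=> // v; apply: IH.
Qed.

Lemma is_Cn_continuous V W j (U : set V) (f : V -> W) :
  is_Cn j U f -> forall x, U x -> {for x, continuous f}.
Proof. by elim: j => [//|j IH] /is_CnW. Qed.

Lemma is_Cn_cst V W j (U : set V) (w : W) : is_Cn j U (fun=> w).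
Proof.
elim: j w => [|j IH] w /=; first by move=> x _; apply: cst_continuous.
split=> [x _|v]; first exact: differentiable_cst.
rewrite (_ : (fun x => _) = fun=> 0) //; apply: funext => x.
by rewrite (diff_cst (w : W) x).
Qed.

Lemma is_Cn_linear V W j (U : set V) (f : {linear V -> W}) :
  continuous f -> is_Cn j U f.
Proof.
move=> cf; case: j => [|j] /=; first by move=> x _; apply: cf.
split=> [x _|v]; first exact: linear_differentiable.
rewrite (_ : (fun x => _) = fun=> f v); first exact: is_Cn_cst.
by apply: funext => x; rewrite diff_lin.
Qed.

Lemma is_Cn_linear_comp V W Y j (U : set V) (f : V -> W) (g : {linear W -> Y}) :
  open U -> continuous g -> is_Cn j U f -> is_Cn j U (g \o f).
Proof.
move=> oU cg; elim: j f => [|j IH] f /=.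
  by move=> cf x Ux; apply: continuous_comp; [apply: cf|apply: cg].
move=> [df dfv]; split=> [x Ux|v].
  by apply: (differentiable_comp (df x Ux)); apply: linear_differentiable.
apply: is_Cn_eq oU _ (IH _ (dfv v)) => x Ux /=.
have dg : differentiable g (f x) by apply: linear_differentiable.
have dgf := congr1 (@^~ v) (diff_comp (df x Ux) dg).
by apply/esym/(etrans dgf); rewrite /= diff_lin.
Qed.

Lemma is_CnD V W j (U : set V) (f g : V -> W) :
  open U -> is_Cn j U f -> is_Cn j U g -> is_Cn j U (fun x => f x + g x).
Proof.
move=> oU; elim: j f g => [|j IH] f g /=.
  by move=> cf cg x Ux; apply: continuousD; [apply: cf|apply: cg].
move=> [df dfv] [dg dgv]; split=> [x Ux|v].
  by apply: differentiableD; [apply: df|apply: dg].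
apply: is_Cn_eq oU _ (IH _ _ (dfv v) (dgv v)) => x Ux /=.
exact/esym/(congr1 (@^~ v) (diffD (df x Ux) (dg x Ux))).
Qed.

Lemma is_Cn_sum V W j (U : set V) (I : Type) (r : seq I) (F : I -> V -> W) :
  open U -> (forall i, is_Cn j U (F i)) ->
  is_Cn j U (fun x => \sum_(i <- r) F i x).
Proof.
move=> oU CF; elim: r => [|i r IH].
  by under eq_fun do rewrite big_nil; apply: is_Cn_cst.
by under eq_fun do rewrite big_cons; apply: is_CnD.
Qed.

Lemma is_CnM V j (U : set V) (f g : V -> R) :
  open U -> is_Cn j U f -> is_Cn j U g -> is_Cn j U (fun x => f x * g x).
Proof.
move=> oU; elim: j f g => [|j IH] f g /=.
  by move=> cf cg x Ux; apply: continuousM; [apply: cf|apply: cg].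
move=> Cf Cg; have [df dfv] := Cf; have [dg dgv] := Cg.
split=> [x Ux|v].
  by apply: differentiableM; [apply: df|apply: dg].
apply: is_Cn_eq oU _ (is_CnD oU (IH _ _ (is_CnW Cf) (dgv v))
                                (IH _ _ (is_CnW Cg) (dfv v))) => x Ux /=.
exact/esym/(congr1 (@^~ v) (diffM (df x Ux) (dg x Ux))).
Qed.

Lemma is_Cn_prod V j (U : set V) (I : Type) (r : seq I) (F : I -> V -> R) :
  open U -> (forall i, is_Cn j U (F i)) ->
  is_Cn j U (fun x => \prod_(i <- r) F i x).
Proof.
move=> oU CF; elim: r => [|i r IH].
  by under eq_fun do rewrite big_nil; apply: is_Cn_cst.
by under eq_fun do rewrite big_cons; apply: is_CnM.
Qed.

Lemma is_CnN V W j (U : set V) (f : V -> W) :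
  open U -> is_Cn j U f -> is_Cn j U (fun x => - f x).
Proof.
by move=> oU; apply: (is_Cn_linear_comp (g := -%R)) => //; apply: opp_continuous.
Qed.

Lemma is_CnV V j (U : set V) (f : V -> R) :
  open U -> (forall x, U x -> f x != 0) -> is_Cn j U f ->
  is_Cn j U (fun x => (f x)^-1).
Proof.
move=> oU f0; elim: j => [|j IH].
  by move=> cf x Ux; apply: cvgV; [exact: f0|exact: cf].
move=> Cf; have [df dfv] := Cf; split=> [x Ux|v].
  by apply: differentiableV; [apply: df|apply: f0].
(* The derivative [- f^-1 * f^-1 * 'd f] contains [f^-1] again, which the induction supplies at one
   order lower. *)
have CV := IH (is_CnW Cf).
apply: is_Cn_eq oU _ (is_CnN oU (is_CnM oU (is_CnM oU CV CV) (dfv v))) => x Ux.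
apply/esym; apply: etrans (congr1 (@^~ v) (diffV (df x Ux) (f0 x Ux))) _.
by rewrite /= -exprVn expr2 scaleNr.
Qed.

End RegularMaps.

(** [is_Cn] differentiates in fixed directions, whereas the chain rule produces a direction that
    moves with the point. Expanding it on the fixed vectors [e], with continuous linear coordinates
    [c], brings back fixed directions. *)
Definition finite_coords (R : realType) (V : normedModType R) : Prop :=
  exists (I : finType) (e : I -> V) (c : I -> {linear V -> R}),
    (forall i, continuous (c i)) /\ forall v, v = \sum_i c i v *: e i.

Lemma finite_coords_mx (R : realType) (m n : nat) :
  finite_coords 'M[R]_(m, n).
Proof.
have lin (i : 'I_m * 'I_n) : linear (fun M : 'M[R]_(m, n) => M i.1 i.2 : R).
  by move=> a M N; rewrite !mxE.
pose c i : {linear 'M[R]_(m, n) -> R} :=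
  HB.pack (fun M : 'M[R]_(m, n) => M i.1 i.2 : R)
          (GRing.isLinear.Build _ _ _ _ _ (lin i)).
exists ('I_m * 'I_n)%type, (fun i => delta_mx i.1 i.2), c; split=> [i|M].
  exact: coord_continuous.
by rewrite {1}[M]matrix_sum_delta pair_bigA.
Qed.

Lemma finite_coords_prod (R : realType) (V W : normedModType R) :
  finite_coords V -> finite_coords W -> finite_coords (V * W)%type.
Proof.
move=> [I [e [c [cc cE]]]] [J [e' [c' [cc' cE']]]].
pose k (i : I + J) : {linear (V * W)%type -> R} :=
  match i with inl i => c i \o fst | inr j => c' j \o snd end.
exists (I + J)%type, (fun i => match i with inl i => (e i, 0) | inr j => (0, e' j) end), k.
split=> [[i|j] /=|v].
- by move=> x; apply: continuous_comp; [exact: cvg_fst|exact: cc].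
- by move=> x; apply: continuous_comp; [exact: cvg_snd|exact: cc'].
rewrite big_sumType /=; case: v => x y.
have -> : \sum_i k (inl i) (x, y) *: (e i, 0 : W) = (\sum_i c i x *: e i, 0).
  elim/big_ind2: _ => // [a1 a b1 b -> -> | i _].
    by congr (_, _); rewrite /= addr0.
  by congr (_, _); rewrite /= scaler0.
have -> : \sum_j k (inr j) (x, y) *: (0 : V, e' j) = (0, \sum_j c' j y *: e' j).
  elim/big_ind2: _ => // [a1 a b1 b -> -> | i _].
    by congr (_, _); rewrite /= addr0.
  by congr (_, _); rewrite /= scaler0.
by rewrite -cE -cE'; congr (_, _); rewrite /= ?addr0 ?add0r.
Qed.

(** * Composition and matrix operations for C^k maps in finite dimension *)

Section RegularMapsFiniteDim.
Context {R : realType}.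
Implicit Types V W Y : normedModType R.

Lemma is_CnZl V W j (U : set V) (f : V -> R) (w : W) :
  open U -> is_Cn j U f -> is_Cn j U (fun x => f x *: w).
Proof.
move=> oU.
have lin : linear (fun t : R => t *: w).
  by move=> a s t; rewrite scalerDl scalerA.
pose g : {linear R -> W} := HB.pack (fun t : R => t *: w)
                           (GRing.isLinear.Build _ _ _ _ _ lin).
by apply: (is_Cn_linear_comp (g := g) oU); apply: scalel_continuous.
Qed.

Lemma is_CnZ V W j (U : set V) (k : V -> R) (f : V -> W) :
  finite_coords W -> open U ->
  is_Cn j U k -> is_Cn j U f -> is_Cn j U (fun x => k x *: f x).
Proof.
move=> [I [e [c [cc cE]]]] oU Ck Cf.
rewrite (_ : (fun x => _) = fun x => \sum_i (k x * c i (f x)) *: e i); last first.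
  apply: funext => x; rewrite {1}[f x]cE scaler_sumr.
  by apply: eq_bigr => i _; rewrite scalerA.
apply: is_Cn_sum => // i; apply: is_CnZl => //; apply: is_CnM => //.
exact: is_Cn_linear_comp.
Qed.

Lemma is_Cn_comp V W Y j (U : set V) (O : set W) (f : V -> W) (g : W -> Y) :
  finite_coords W -> finite_coords Y -> open U -> open O ->
  (forall x, U x -> O (f x)) ->
  is_Cn j U f -> is_Cn j O g -> is_Cn j U (g \o f).
Proof.
move=> fW fY oU oO UO; elim: j f g UO => [|j IH] f g UO /=.
  by move=> cf cg x Ux; apply: continuous_comp; [apply: cf|apply/cg/UO].
move=> Cf [dg dgv]; have [df dfv] := Cf; split=> [x Ux|v].
  by apply: differentiable_comp; [apply: df|apply/dg/UO].
have [I [e [c [cc cE]]]] := fW.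
(* This is the chain rule with the moving direction ['d f x v] expanded on [e]: each summand is a
   C^j scalar times a composite covered by the induction. *)
have Cs : is_Cn j U
    (fun x => \sum_i c i ('d f x v) *: ((fun y => 'd g y (e i)) \o f) x).
  apply: is_Cn_sum => // i; apply: is_CnZ => //.
    exact: (is_Cn_linear_comp (f := fun x => 'd f x v)).
  by apply: IH => //; apply: is_CnW.
apply: is_Cn_eq oU _ Cs => x Ux.
have dgf := congr1 (@^~ v) (diff_comp (df x Ux) (dg _ (UO _ Ux))).
apply/esym/(etrans dgf) => /=; rewrite {1}[X in 'd g (f x) X]cE linear_sum.
by apply: eq_bigr => i _; rewrite linearZ.
Qed.

Lemma is_Cn_pair V W Y j (U : set V) (f : V -> W) (g : V -> Y) :
  open U -> is_Cn j U f -> is_Cn j U g -> is_Cn j U (fun x => (f x, g x)).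
Proof.
move=> oU; elim: j f g => [|j IH] f g /=.
  by move=> cf cg x Ux; apply: cvg_pair; [apply: cf|apply: cg].
move=> [df dfv] [dg dgv]; split=> [x Ux|v].
  by apply: differentiable_pair; [apply: df|apply: dg].
apply: is_Cn_eq oU _ (IH _ _ (dfv v) (dgv v)) => x Ux /=.
exact/esym/(congr1 (@^~ v) (diff_pair (df x Ux) (dg x Ux))).
Qed.

Lemma is_Cn_fst V W Y j (U : set V) (f : V -> (W * Y)%type) :
  open U -> is_Cn j U f -> is_Cn j U (fun x => (f x).1).
Proof.
by move=> oU; apply: (is_Cn_linear_comp (g := fst)) => // x; apply: cvg_fst.
Qed.

Lemma is_Cn_snd V W Y j (U : set V) (f : V -> (W * Y)%type) :
  open U -> is_Cn j U f -> is_Cn j U (fun x => (f x).2).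
Proof.
by move=> oU; apply: (is_Cn_linear_comp (g := snd)) => // x; apply: cvg_snd.
Qed.

Lemma is_Cn_id V j (U : set V) : is_Cn j U (@id V).
Proof. by apply: (@is_Cn_linear _ _ _ j U idfun) => x. Qed.

Lemma is_Cn_mxP V j (U : set V) m n (f : V -> 'M[R]_(m, n)) :
  open U ->
  is_Cn j U f <-> forall a b, is_Cn j U (fun x => f x a b).
Proof.
move=> oU; split=> [Cf a b|Cf].
  have lin : linear (fun M : 'M[R]_(m, n) => M a b : R).
    by move=> k M N; rewrite !mxE.
  pose g : {linear 'M[R]_(m, n) -> R} := HB.pack (fun M : 'M[R]_(m, n) => M a b : R)
                           (GRing.isLinear.Build _ _ _ _ _ lin).
  by apply: (is_Cn_linear_comp (g := g)) => //; apply: coord_continuous.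
rewrite (_ : f = fun x => \sum_a \sum_b f x a b *: delta_mx a b); last first.
  by apply: funext => x; rewrite -matrix_sum_delta.
by do 2![apply: is_Cn_sum => // ?]; apply: is_CnZl.
Qed.

Lemma is_Cn_mulmx V j (U : set V) m n p
    (f : V -> 'M[R]_(m, n)) (g : V -> 'M[R]_(n, p)) :
  open U -> is_Cn j U f -> is_Cn j U g -> is_Cn j U (fun x => f x *m g x).
Proof.
move=> oU /(is_Cn_mxP _ _ oU) Cf /(is_Cn_mxP _ _ oU) Cg.
apply/is_Cn_mxP => // a b; under eq_fun do rewrite mxE.
by apply: is_Cn_sum => // c; apply: is_CnM.
Qed.

Lemma is_Cn_trmx V j (U : set V) m n (f : V -> 'M[R]_(m, n)) :
  open U -> is_Cn j U f -> is_Cn j U (fun x => (f x)^T).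
Proof.
move=> oU /(is_Cn_mxP _ _ oU) Cf.
by apply/is_Cn_mxP => // a b; under eq_fun do rewrite mxE.
Qed.

Lemma is_Cn_det V j (U : set V) n (f : V -> 'M[R]_n) :
  open U -> is_Cn j U f -> is_Cn j U (fun x => \det (f x)).
Proof.
move=> oU /(is_Cn_mxP _ _ oU) Cf; apply: is_Cn_sum => // s.
by apply: is_CnM => //; [exact: is_Cn_cst|exact: is_Cn_prod].
Qed.

Lemma is_Cn_invmx V j (U : set V) n (f : V -> 'M[R]_n) :
  open U -> (forall x, U x -> f x \in unitmx) ->
  is_Cn j U f -> is_Cn j U (fun x => invmx (f x)).
Proof.
move=> oU fU Cf; have /(is_Cn_mxP _ _ oU) Cfc := Cf.
(* Cramer's formula; [invmx] returns its argument on singular matrices, so the two sides are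
   compared on [U] only. *)
apply: (is_Cn_eq (f := fun x => (\det (f x))^-1 *: \adj (f x))) => //.
  by move=> x /fU fx; rewrite /invmx fx.
apply: is_CnZ => //; first exact: finite_coords_mx.
  apply: is_CnV => //; last exact: is_Cn_det.
  by move=> x /fU; rewrite unitmxE unitfE.
apply/is_Cn_mxP => // a b; under eq_fun do rewrite mxE.
apply: is_CnM => //; first exact: is_Cn_cst.
apply: is_Cn_det => //; apply/is_Cn_mxP => // c d.
by under eq_fun do rewrite !mxE.
Qed.

Lemma is_Cn_open_preimage V W j (U : set V) (O : set W) (f : V -> W) :
  open U -> open O -> is_Cn j U f -> open (U `&` f @^-1` O).
Proof.
move=> oU oO /is_Cn_continuous cf; rewrite openE => x [Ux Ofx].
apply: filterI; first exact: open_nbhs_nbhs.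
by apply: cf => //; apply: open_nbhs_nbhs.
Qed.

Lemma open_unitmx n : open [set A : 'M[R]_n | A \in unitmx].
Proof.
rewrite (_ : [set _ | _] = setT `&` (fun A : 'M[R]_n => \det A) @^-1` [set x | x != 0]).
  apply: (is_Cn_open_preimage (j := 0)); [exact: openT|exact: open_neq|].
  exact: is_Cn_det openT (is_Cn_id _ _).
by rewrite setTI; apply/seteqP; split=> A /=; rewrite unitmxE unitfE.
Qed.

(** Reduces both finite regularity and C^oo to statements about single orders [j], so that charts
    are treated once for both. *)
Lemma is_CkP V W (k : option nat) (U : set V) (f : V -> W) :
  is_Ck k U f <-> forall j, (k = Some j \/ k = None) -> is_Cn j U f.
Proof.
case: k => [i|]; split => //=.
- by move=> Cf j [[<-]|].
- by apply; left.
- by move=> Cf j; apply: Cf; right.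
Qed.

End RegularMapsFiniteDim.

(** * Orthogonal projectors and block coordinates *)

Section Projectors.
Context {R : realFieldType}.

(** Each diagonal entry of the product is the sum of the squares of a row of [A]. *)
Lemma mulmx_tr_eq0 m n (A : 'M[R]_(m, n)) : A *m A^T = 0 -> A = 0.
Proof.
move=> AA0; apply/matrixP => i j; rewrite mxE; apply/eqP.
have /matrixP/(_ i i)/eqP := AA0; rewrite !mxE psumr_eq0.
  by move=> /allP/(_ j); rewrite mem_index_enum mxE mulf_eq0 orbb; apply.
by move=> k _; rewrite mxE -expr2 sqr_ge0.
Qed.

(** If x L L^T = 0 then (x L)(x L)^T = 0, so x L = 0, and freeness of the rows gives x = 0. *)
Lemma unitmx_gram m n (L : 'M[R]_(m, n)) : row_free L -> L *m L^T \in unitmx.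
Proof.
move=> freeL; rewrite -row_free_unit -kermx_eq0.
have kL : kermx (L *m L^T) *m L = 0.
  by apply: mulmx_tr_eq0; rewrite trmx_mul !mulmxA -(mulmxA _ L) mulmx_ker mul0mx.
by apply/eqP/(row_free_inj freeL); rewrite mul0mx.
Qed.

(** The orthogonal projector onto the row space of [L] when [L] has free rows. The formula is
    rational in [L], which gives its regularity. *)
Definition row_proj m n (L : 'M[R]_(m, n)) : 'M[R]_n :=
  L^T *m invmx (L *m L^T) *m L.

Section RowProj.
Context {m n : nat} {L : 'M[R]_(m, n)}.
Context (freeL : row_free L).

Lemma mulmx_row_proj : L *m row_proj L = L.
Proof. by rewrite /row_proj !mulmxA mulmxV ?unitmx_gram // mul1mx. Qed.

Lemma trmx_row_proj : (row_proj L)^T = row_proj L.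
Proof.
rewrite /row_proj !trmx_mul trmxK trmx_inv trmx_mul trmxK.
by rewrite !mulmxA.
Qed.

Lemma row_proj_idem : row_proj L *m row_proj L = row_proj L.
Proof. by rewrite {1}/row_proj -mulmxA mulmx_row_proj. Qed.

Lemma mxrank_row_proj : \rank (row_proj L) = m.
Proof.
apply/eqP; rewrite eqn_leq; apply/andP; split.
  by apply: leq_trans (mxrankM_maxr _ _) _; apply: rank_leq_row.
rewrite -{1}(eqP (freeL : \rank L == m)) -{1}mulmx_row_proj.
exact: mxrankM_maxr.
Qed.

(** Two projectors with the same row space absorb each other on the right; transposing one of these
    identities and using symmetry makes them equal. *)
Lemma row_proj_unique (Q : 'M[R]_n) :
  Q^T = Q -> Q *m Q = Q -> (L :=: Q)%MS -> row_proj L = Q.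
Proof.
move=> Qt QQ QL.
have LQ : L *m Q = L.
  have /submxP[C ->] : (L <= Q)%MS by rewrite QL.
  by rewrite -mulmxA QQ.
have QP : Q *m row_proj L = Q.
  have /submxP[C ->] : (Q <= L)%MS by rewrite QL.
  by rewrite -mulmxA mulmx_row_proj.
have PQ : row_proj L *m Q = row_proj L by rewrite {1}/row_proj -mulmxA LQ.
by rewrite -PQ -{1}Qt -trmx_row_proj -trmx_mul QP Qt.
Qed.

End RowProj.

(** For an idempotent, the left kernel of [P] is the row space of 1 - P. *)
Lemma mxrank_compl_idem n (P : 'M[R]_n) :
  P *m P = P -> \rank (1%:M - P) = (n - \rank P)%N.
Proof.
move=> PP; rewrite -mxrank_ker; apply: eqmx_rank; apply/andP; split.
  by apply/sub_kermxP; rewrite mulmxBl mul1mx PP subrr.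
have -> : kermx P = kermx P *m (1%:M - P) by rewrite mulmxBr mulmx1 mulmx_ker subr0.
exact: submxMl.
Qed.

Lemma compl_idem n (P : 'M[R]_n) :
  P *m P = P -> (1%:M - P) *m (1%:M - P) = 1%:M - P.
Proof. by move=> PP; rewrite mulmxBr mulmx1 mulmxBl mul1mx PP subrr subr0. Qed.

End Projectors.

(* Block coordinates: the rows of [rt], [rb] (resp. columns of [c1], [c2], [c3])
   cut m rows into s + u (resp. n columns into s + p + q); [ct], [cb], [r1],
   [r2], [r3] are the dual families. *)
Record block_frame (R : realType) (m n s u p q : nat) := BlockFrame {
  rt : 'M[R]_(s, m); rb : 'M[R]_(u, m);
  ct : 'M[R]_(m, s); cb : 'M[R]_(m, u);
  c1 : 'M[R]_(n, s); c2 : 'M[R]_(n, p); c3 : 'M[R]_(n, q);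
  r1 : 'M[R]_(s, n); r2 : 'M[R]_(p, n); r3 : 'M[R]_(q, n);
  rows0 : 'M[R]_(s + p, n);
  rt_cb : rt *m cb = 0;
  rb_cb : rb *m cb = 1%:M;
  row_blocks : ct *m rt + cb *m rb = 1%:M;
  r2_c1 : r2 *m c1 = 0; r2_c2 : r2 *m c2 = 1%:M; r2_c3 : r2 *m c3 = 0;
  r3_c1 : r3 *m c1 = 0; r3_c2 : r3 *m c2 = 0; r3_c3 : r3 *m c3 = 1%:M;
  col_blocks : c1 *m r1 + c2 *m r2 + c3 *m r3 = 1%:M }.

(** * The coordinates (Y, Z, W) and their inverse *)

Section BlockCoordinates.
Context {R : realType} {m n s u p q : nat}.
Variable F : block_frame R m n s u p q.
Implicit Types (X Y : 'M[R]_(m, n)) (P : 'M[R]_n).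
Local Notation rt := (rt F).
Local Notation rb := (rb F).
Local Notation ct := (ct F).
Local Notation cb := (cb F).
Local Notation c1 := (c1 F).
Local Notation c2 := (c2 F).
Local Notation c3 := (c3 F).
Local Notation r1 := (r1 F).
Local Notation r2 := (r2 F).
Local Notation r3 := (r3 F).
Local Notation rows0 := (rows0 F).

Definition pivot X : 'M[R]_s := rt *m X *m c1.

(* In block form, X = [A, B; C, D] with pivot A, and [rank_part X] is
   [A, B; C, C A^-1 B]. *)
Definition rank_part X : 'M[R]_(m, n) :=
  X *m c1 *m invmx (pivot X) *m (rt *m X).

(** In block form X - [rank_part X] is zero except for the Schur complement D - C A^-1 B; its
    columns along [c2] form the block Z. *)
Definition excess X : 'M[R]_(u, p) := rb *m (X - rank_part X) *m c2.

(** [rows0] selects s + p combinations of the rows of 1 - P, and this is their square block in the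
    first s + p columns. For P of corank s + p, invertibility says that they form a basis of the row
    space. *)
Definition pivotP P : 'M[R]_(s + p) := rows0 *m (1%:M - P) *m row_mx c1 c2.

(** The block W of the reduced basis [I, 0, *; 0, I, W] of the row space of 1 - P: lower p rows,
    last q columns. *)
Definition kernel_slope P : 'M[R]_(p, q) :=
  dsubmx (invmx (pivotP P) *m (rows0 *m (1%:M - P) *m c3)).

(** The rows [0, I, W] in the column blocks of the frame. *)
Definition slope_rows (W : 'M[R]_(p, q)) : 'M[R]_(p, n) := r2 + W *m r3.

(* The rows form a basis of the row space of 1 - P. *)
Definition coker_rows X (W : 'M[R]_(p, q)) : 'M[R]_(s + p, n) :=
  col_mx (invmx (pivot X) *m (rt *m X)) (slope_rows W).

Definition param Y (Z : 'M[R]_(u, p)) (W : 'M[R]_(p, q)) : 'M[R]_(m, n) * 'M[R]_n :=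
  (Y + cb *m Z *m slope_rows W, 1%:M - row_proj (coker_rows Y W)).

Lemma slope_rows_c1 W : slope_rows W *m c1 = 0.
Proof. by rewrite mulmxDl -mulmxA r2_c1 r3_c1 mulmx0 addr0. Qed.

Lemma slope_rows_c2 W : slope_rows W *m c2 = 1%:M.
Proof. by rewrite mulmxDl -mulmxA r2_c2 r3_c2 mulmx0 addr0. Qed.

Lemma slope_rows_c3 W : slope_rows W *m c3 = W.
Proof. by rewrite mulmxDl -mulmxA r2_c3 r3_c3 mulmx1 add0r. Qed.

Lemma slope_rowsE (M : 'M[R]_(p, n)) :
  M *m c1 = 0 -> M *m c2 = 1%:M -> M = slope_rows (M *m c3).
Proof.
move=> M1 M2; rewrite -{1}[M]mulmx1 -(col_blocks F) !mulmxDr !mulmxA M1 M2.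
by rewrite mul0mx mul1mx add0r.
Qed.

Lemma pivot_rank_part X : pivot X \in unitmx -> pivot (rank_part X) = pivot X.
Proof.
move=> uX; rewrite {1}/pivot /rank_part !mulmxA.
by rewrite -/(pivot X) mulmxV // mul1mx.
Qed.

Lemma mxrank_rank_part X : pivot X \in unitmx -> \rank (rank_part X) = s.
Proof.
move=> uX; apply/eqP; rewrite eqn_leq; apply/andP; split.
  by rewrite /rank_part -mulmxA; apply: leq_trans (mxrankM_maxr _ _) (rank_leq_row _).
have <- : \rank (pivot (rank_part X)) = s by rewrite pivot_rank_part // mxrank_unit.
by apply: leq_trans (mxrankM_maxl _ _) (mxrankM_maxr _ _).
Qed.

(** An invertible pivot forces the s rows [rt *m X] to span the row space of [X]. Writing X = C (rt
    X) and reading the columns [c1] gives C = X c1 A^-1, which is the formula of [rank_part]. *)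
Lemma rank_part_id X : pivot X \in unitmx -> \rank X = s -> rank_part X = X.
Proof.
move=> uX rX.
have /submxP[C XC] : (X <= rt *m X)%MS.
  rewrite -(geq_leqif (mxrank_leqif_sup (submxMl rt X))) rX.
  by rewrite -{1}(mxrank_unit uX); apply: mxrankM_maxl.
have CX : C *m pivot X = X *m c1 by rewrite /pivot mulmxA -XC.
by rewrite /rank_part -CX mulmxK.
Qed.

Lemma excess0 X : pivot X \in unitmx -> \rank X = s -> excess X = 0.
Proof. by move=> uX rX; rewrite /excess rank_part_id // subrr mulmx0 mul0mx. Qed.

Lemma coker_rows_blocks Y W : pivot Y \in unitmx ->
  coker_rows Y W *m row_mx c1 c2 =
  block_mx 1%:M (invmx (pivot Y) *m (rt *m Y) *m c2) 0 1%:M.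
Proof.
move=> uY; rewrite mul_col_mx !mul_mx_row slope_rows_c1 slope_rows_c2.
by rewrite -(mulmxA _ _ c1) -/(pivot Y) mulVmx.
Qed.

(** On the columns [c1], [c2] these rows form a unipotent upper triangular matrix. *)
Lemma coker_rows_free Y W : pivot Y \in unitmx -> row_free (coker_rows Y W).
Proof.
move=> uY; apply/row_freeP; pose K := coker_rows Y W *m row_mx c1 c2.
exists (row_mx c1 c2 *m invmx K); rewrite mulmxA -/K mulmxV //.
by rewrite /K coker_rows_blocks // unitmxE det_ublock !det1 mul1r unitr1.
Qed.

Section Param.
Context {Y : 'M[R]_(m, n)} (Z : 'M[R]_(u, p)) (W : 'M[R]_(p, q)).
Context (uY : pivot Y \in unitmx) (rY : \rank Y = s).

Lemma param_c1 : (param Y Z W).1 *m c1 = Y *m c1.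
Proof. by rewrite mulmxDl -!mulmxA slope_rows_c1 !mulmx0 addr0. Qed.

Lemma param_rt : rt *m (param Y Z W).1 = rt *m Y.
Proof. by rewrite mulmxDr !mulmxA rt_cb !mul0mx addr0. Qed.

Lemma pivot_param : pivot (param Y Z W).1 = pivot Y.
Proof. by rewrite /pivot param_rt. Qed.

Lemma rank_part_param : rank_part (param Y Z W).1 = Y.
Proof.
by rewrite -[RHS](rank_part_id uY rY) /rank_part pivot_param param_rt param_c1.
Qed.

Lemma excess_param : excess (param Y Z W).1 = Z.
Proof.
rewrite /excess rank_part_param /= addrAC subrr add0r.
by rewrite !mulmxA rb_cb mul1mx -mulmxA slope_rows_c2 mulmx1.
Qed.

(** The selected rows of the projector are [c *m L] with [c] square. Invertibility of [pivotP] makes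
    [c] invertible, so it cancels; the remaining system is block triangular and its lower line reads
    W. *)
Lemma kernel_slope_param :
  pivotP (param Y Z W).2 \in unitmx -> kernel_slope (param Y Z W).2 = W.
Proof.
rewrite /kernel_slope /pivotP /= opprB addrC subrK.
set L := coker_rows Y W.
set c := rows0 *m (L^T *m invmx (L *m L^T)).
have -> : rows0 *m row_proj L = c *m L by rewrite /c /row_proj !mulmxA.
rewrite -!(mulmxA c) unitmx_mul => /andP[uc uL].
set T := invmx _ *m _.
have cT : c *m (L *m row_mx c1 c2) *m T = c *m (L *m c3).
  by apply: mulKVmx; rewrite unitmx_mul; apply/andP.
have : L *m row_mx c1 c2 *m T = L *m c3.
  by apply: (can_inj (mulKmx uc)); rewrite -cT !mulmxA.
rewrite {1}/L coker_rows_blocks // -{1}[T]vsubmxK mul_block_col mul_col_mx.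
by move=> /eq_col_mx[_]; rewrite mul0mx add0r mul1mx slope_rows_c3.
Qed.

Lemma param_factor : exists C, (param Y Z W).1 = C *m coker_rows Y W.
Proof.
exists (row_mx (Y *m c1) (cb *m Z)); rewrite mul_row_col /=; congr (_ + _).
by rewrite mulmxA -/(rank_part Y) rank_part_id.
Qed.

Lemma param_desing : desing R m n (s + p) (param Y Z W).
Proof.
have freeL := coker_rows_free W uY.
split.
  split; rewrite /Sym /=.
  - by rewrite linearB /= trmx1 trmx_row_proj.
  - exact/compl_idem/row_proj_idem.
  - by rewrite mxrank_compl_idem ?mxrank_row_proj //; apply: row_proj_idem.
have [C ->] := param_factor.
by rewrite /= mulmxBr mulmx1 -(mulmxA C) mulmx_row_proj // subrr.
Qed.

End Param.

Lemma param0 Y W : (param Y 0 W).1 = Y.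
Proof. by rewrite /= mulmx0 mul0mx addr0. Qed.

Lemma param_coords X P : (s + p <= n)%N -> pivot X \in unitmx -> pivotP P \in unitmx ->
  desing R m n (s + p) (X, P) ->
  param (rank_part X) (excess X) (kernel_slope P) = (X, P).
Proof.
move=> spn uX uP [[/= Pt PP rP] XP].
set Q := 1%:M - P.
have Qt : Q^T = Q by rewrite linearB /= trmx1 Pt.
have QQ : Q *m Q = Q by apply: compl_idem.
have rQ : \rank Q = (s + p)%N by rewrite mxrank_compl_idem // rP subKn.
have XQ : X *m Q = X by rewrite mulmxBr mulmx1 XP subr0.
(* [B] is the basis of the row space of [Q] normalized to the identity on the columns [c1], [c2]. *)
pose B := invmx (pivotP P) *m (rows0 *m Q).
have BJ : B *m row_mx c1 c2 = 1%:M by rewrite -mulmxA mulVmx.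
have BQ : (B :=: Q)%MS.
  apply/eqmxP; have BQ : (B <= Q)%MS by rewrite /B mulmxA submxMl.
  rewrite BQ -(geq_leqif (mxrank_leqif_sup BQ)) rQ /=.
  by rewrite -{1}(mxrank1 R (s + p)) -BJ; apply: mxrankM_maxl.
pose B1 := usubmx B; pose B2 := dsubmx B.
have [B11 B12 B21 B22] : [/\ B1 *m c1 = 1%:M, B1 *m c2 = 0, B2 *m c1 = 0 & B2 *m c2 = 1%:M].
  move: BJ; rewrite -[B]vsubmxK mul_col_mx !mul_mx_row scalar_mx_block.
  by move=> /eq_block_mx[].
have B2E : slope_rows (kernel_slope P) = B2.
  rewrite (slope_rowsE B21 B22) /kernel_slope mul_dsub_mx.
  by rewrite /B !mulmxA.
pose W := kernel_slope P.
(* The rows of [X] lie in the span of [B], and their coefficients are read off on the columns where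
   [B] is the identity. *)
have XB : X = X *m c1 *m B1 + X *m c2 *m B2.
  have /submxP[C XC] : (X <= B)%MS by rewrite BQ -XQ submxMl.
  have -> : X *m c1 *m B1 + X *m c2 *m B2 = X *m row_mx c1 c2 *m B.
    by rewrite -[B in RHS]vsubmxK mul_mx_row mul_row_col.
  by rewrite {2}XC -(mulmxA C) BJ mulmx1.
pose T := invmx (pivot X) *m (rt *m X).
(* [T] differs from [B1] by multiples of [B2], so [T] and [B2] again lie in the row space of [Q]; a
   rank count then shows that they span it. *)
have TE : T = B1 + T *m c2 *m B2.
  have rtX : rt *m X = pivot X *m B1 + rt *m X *m c2 *m B2.
    by rewrite {1}XB mulmxDr !mulmxA.
  rewrite {1}/T {1}rtX mulmxDr mulKmx //.
  by congr (_ + _); rewrite /T !mulmxA.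
have rtY : rt *m rank_part X = rt *m X.
  by rewrite /rank_part !mulmxA -/(pivot X) mulmxV // mul1mx.
have LE : coker_rows (rank_part X) W = col_mx T B2.
  by rewrite /coker_rows pivot_rank_part // rtY B2E.
have LQ : (coker_rows (rank_part X) W :=: Q)%MS.
  apply/eqmxP; have LQ : (coker_rows (rank_part X) W <= Q)%MS.
    have : (col_mx B1 B2 <= Q)%MS by rewrite vsubmxK BQ.
    rewrite LE !col_mx_sub => /andP[sB1 sB2].
    by rewrite sB2 andbT TE addmx_sub ?mulmx_sub.
  rewrite LQ -(geq_leqif (mxrank_leqif_sup LQ)) rQ /= LE -LE.
  by rewrite (eqP (coker_rows_free W _)) // pivot_rank_part.
have freeL : row_free (coker_rows (rank_part X) W).
  by apply: coker_rows_free; rewrite pivot_rank_part.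
rewrite /param -/W (row_proj_unique freeL Qt QQ LQ) /Q subKr.
congr (_, _).
(* In X - X c1 T the contributions of [B1] cancel, which leaves a multiple of [B2] with coefficient
   [G]. *)
pose G := X *m c2 - X *m c1 *m T *m c2.
have XG : X - rank_part X = G *m B2.
  rewrite /rank_part -(mulmxA _ (invmx _)) -/T {1}TE mulmxDr opprD addrA.
  rewrite {1}XB (addrC (X *m c1 *m B1)) addrK mulmxBl; congr (_ - _).
  by rewrite !mulmxA.
have rtG : rt *m G = 0.
  have -> : G = (X - rank_part X) *m c2 by rewrite XG -mulmxA B22 mulmx1.
  by rewrite mulmxA mulmxBr rtY subrr mul0mx.
have -> : excess X = rb *m G by rewrite /excess XG -!mulmxA B22 mulmx1.
(* Since [rt *m G = 0], the decomposition of the identity on the row side gives cb rb G = G. *)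
rewrite B2E mulmxA -[cb *m rb](addKr (ct *m rt)) row_blocks.
rewrite mulmxDl mulNmx -mulmxA rtG mulmx0 oppr0 add0r mul1mx -XG.
by rewrite addrC subrK.
Qed.

End BlockCoordinates.

Lemma row_full_inverse (R : fieldType) a n (A : 'M[R]_(a, n)) :
  a = n -> row_full A -> exists H, A *m H = 1%:M /\ H *m A = 1%:M.
Proof.
by move=> an; subst a => /row_fullP[H HA]; exists H; split=> //; apply: mulmx1C.
Qed.

Lemma row_base_of_rank (R : fieldType) a n k (A : 'M[R]_(a, n)) :
  \rank A = k -> exists B : 'M[R]_(k, n), (B :=: A)%MS.
Proof. by move=> <-; exists (row_base A); apply: eq_row_base. Qed.

(** The rows of X lie in the row space of Q = 1 - P. A basis [B1] of the former, completed by [B2]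
    within the latter and by [B3] to the whole space, has the dual columns [c1], [c2], [c3]. With
    this choice both pivots are identity matrices. *)
Lemma block_frame_exists (R : realType) m n s u p q
    (X : 'M[R]_(m, n)) (P : 'M[R]_n) :
  (s + u = m)%N -> (s + p + q = n)%N -> \rank X = s ->
  desing R m n (s + p) (X, P) ->
  exists F : block_frame R m n s u p q,
    pivot F X \in unitmx /\ pivotP F P \in unitmx.
Proof.
move=> mE nE rX [[/= _ PP rP] XP]; set Q := 1%:M - P.
have rQ : \rank Q = (s + p)%N.
  by rewrite mxrank_compl_idem // rP subKn // -nE leq_addr.
have XQ : (X <= Q)%MS.
  have -> : X = X *m Q by rewrite mulmxBr mulmx1 XP subr0.
  exact: submxMl.
have [B1 B1X] := row_base_of_rank rX.
have [B2 B2X] : exists B : 'M[R]_(p, n), (B :=: Q :\: X)%MS.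
  apply: row_base_of_rank; apply/eqP.
  have := mxrank_cap_compl Q X; rewrite rQ (capmx_idPr XQ) rX.
  by move/eqP; rewrite eqn_add2l.
have [B3 B3X] : exists B : 'M[R]_(q, n), (B :=: Q^C)%MS.
  by apply: row_base_of_rank; rewrite mxrank_compl rQ -nE addKn.
have QE : (col_mx B1 B2 :=: Q)%MS.
  apply: eqmx_trans (eqmx_sym (addsmxE _ _)) _.
  apply: eqmx_trans (adds_eqmx B1X B2X) _; rewrite addsmxC.
  apply: eqmx_trans (adds_eqmx (eqmx_refl _) _) (addsmx_diff_cap_eq Q X).
  exact/eqmx_sym/capmx_idPr.
have [H [BH HB]] : exists H, col_mx (col_mx B1 B2) B3 *m H = 1%:M /\
    H *m col_mx (col_mx B1 B2) B3 = 1%:M.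
  apply: row_full_inverse => //.
  rewrite /row_full -addsmxE (adds_eqmx QE B3X); exact: addsmx_compl_full.
have [a Xa] : exists a, X = a *m B1 by apply/submxP; rewrite B1X.
(* As [X] has rank s, the factor [a] has full column rank; [rt] is a left inverse, chosen so that
   [rt *m X] is [B1]. *)
have [rt rta] : exists rt, rt *m a = 1%:M.
  apply/row_fullP; rewrite /row_full eqn_leq rank_leq_col /=.
  by rewrite -{1}rX Xa mxrankM_maxl.
have [rb rbE] : exists B : 'M[R]_(u, m), (B :=: rt^C)%MS.
  apply: row_base_of_rank; have -> : \rank rt^C%MS = (m - s)%N.
    rewrite mxrank_compl; congr (_ - _)%N; apply/eqP.
    by have : row_free rt by apply/row_freeP; exists a.
  by rewrite -mE addKn.
have [G [rG Gr]] : exists G, col_mx rt rb *m G = 1%:M /\ G *m col_mx rt rb = 1%:M.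
  apply: row_full_inverse => //.
  rewrite /row_full -addsmxE (adds_eqmx (eqmx_refl _) rbE); exact: addsmx_compl_full.
have [N NE] : exists N, col_mx B1 B2 = N *m Q by apply/submxP; rewrite QE.
move: rG Gr; rewrite -[G]hsubmxK; set ct := lsubmx G; set cb := rsubmx G.
rewrite mul_col_row mul_row_col (scalar_mx_block s u 1).
move=> /eq_block_mx[rtct rtcb rbct rbcb] GE.
move: BH HB; rewrite -[H]hsubmxK -[lsubmx H]hsubmxK.
set c1 := lsubmx (lsubmx H); set c2 := rsubmx (lsubmx H); set c3 := rsubmx H.
rewrite mul_col_row !mul_row_col (scalar_mx_block (s + p) q 1).
move=> /eq_block_mx[/[dup] pP + + + r3c3].
rewrite mul_col_row (scalar_mx_block s p 1) => /eq_block_mx[r1c1 r1c2 r2c1 r2c2].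
rewrite mul_col_mx -(col_mx0 R s p q) => /eq_col_mx[_ r2c3].
rewrite mul_mx_row -(row_mx0 R q s p) => /eq_row_mx[r3c1 r3c2] HE.
exists (BlockFrame N rtcb rbcb GE r2c1 r2c2 r2c3 r3c1 r3c2 r3c3 HE); split.
  rewrite /pivot /= Xa mulmxA rta mul1mx r1c1; exact: unitmx1.
rewrite /pivotP /= -/Q -NE pP; exact: unitmx1.
Qed.

(** * Charts of the desingularization *)

Section SmoothCoordinates.
Context {R : realType} {E : normedModType R} {j : nat} {U : set E}.
Context (oU : open U).

(** A linear map on matrices combines the entries with the fixed coefficients [g (delta_mx a b)], so
    continuity of [g] comes for free. *)
Lemma is_Cn_linear_mx (W : normedModType R) m n (f : E -> 'M[R]_(m, n))
    (g : {linear 'M[R]_(m, n) -> W}) :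
  is_Cn j U f -> is_Cn j U (fun x => g (f x)).
Proof.
move=> /(is_Cn_mxP _ _ oU) Cf.
rewrite (_ : (fun x => _) = fun x => \sum_a \sum_b f x a b *: g (delta_mx a b)).
  by do 2![apply: is_Cn_sum => // ?]; apply: is_CnZl.
apply: funext => x; rewrite [in LHS](matrix_sum_delta (f x)) linear_sum.
by apply: eq_bigr => a _; rewrite linear_sum; apply: eq_bigr => b _; rewrite linearZ.
Qed.

Lemma is_Cn_mulmxl a m n (C : 'M[R]_(a, m)) (f : E -> 'M[R]_(m, n)) :
  is_Cn j U f -> is_Cn j U (fun x => C *m f x).
Proof. by apply: is_Cn_mulmx => //; apply: is_Cn_cst. Qed.

Lemma is_Cn_mulmxr m n b (C : 'M[R]_(n, b)) (f : E -> 'M[R]_(m, n)) :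
  is_Cn j U f -> is_Cn j U (fun x => f x *m C).
Proof. by move=> Cf; apply: is_Cn_mulmx => //; apply: is_Cn_cst. Qed.

Lemma is_CnB (W : normedModType R) (f g : E -> W) :
  is_Cn j U f -> is_Cn j U g -> is_Cn j U (fun x => f x - g x).
Proof. by move=> Cf Cg; apply: is_CnD => //; apply: is_CnN. Qed.

Lemma is_Cn_row_mx m a b (f : E -> 'M[R]_(m, a)) (g : E -> 'M[R]_(m, b)) :
  is_Cn j U f -> is_Cn j U g -> is_Cn j U (fun x => row_mx (f x) (g x)).
Proof.
move=> /(is_Cn_mxP _ _ oU) Cf /(is_Cn_mxP _ _ oU) Cg.
by apply/is_Cn_mxP => // i l; under eq_fun do rewrite mxE; case: (fintype.split l).
Qed.

Lemma is_Cn_col_mx n a b (f : E -> 'M[R]_(a, n)) (g : E -> 'M[R]_(b, n)) :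
  is_Cn j U f -> is_Cn j U g -> is_Cn j U (fun x => col_mx (f x) (g x)).
Proof.
move=> /(is_Cn_mxP _ _ oU) Cf /(is_Cn_mxP _ _ oU) Cg.
by apply/is_Cn_mxP => // i l; under eq_fun do rewrite mxE; case: (fintype.split i).
Qed.

Context {m n s u p q : nat} (F : block_frame R m n s u p q).

Lemma is_Cn_pivot (X : E -> 'M[R]_(m, n)) :
  is_Cn j U X -> is_Cn j U (fun x => pivot F (X x)).
Proof. by move=> CX; apply/is_Cn_mulmxr/is_Cn_mulmxl. Qed.

Lemma is_Cn_rank_part (X : E -> 'M[R]_(m, n)) :
  (forall x, U x -> pivot F (X x) \in unitmx) ->
  is_Cn j U X -> is_Cn j U (fun x => rank_part F (X x)).
Proof.
move=> uX CX; apply: is_Cn_mulmx => //; last exact: is_Cn_mulmxl.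
apply: is_Cn_mulmx => //; first exact: is_Cn_mulmxr.
exact/is_Cn_invmx/is_Cn_pivot.
Qed.

Lemma is_Cn_excess (X : E -> 'M[R]_(m, n)) :
  (forall x, U x -> pivot F (X x) \in unitmx) ->
  is_Cn j U X -> is_Cn j U (fun x => excess F (X x)).
Proof.
move=> uX CX; apply/is_Cn_mulmxr/is_Cn_mulmxl/is_CnB => //.
exact: is_Cn_rank_part.
Qed.

Lemma is_Cn_pivotP (P : E -> 'M[R]_n) :
  is_Cn j U P -> is_Cn j U (fun x => pivotP F (P x)).
Proof.
by move=> CP; apply/is_Cn_mulmxr/is_Cn_mulmxl/is_CnB => //; apply: is_Cn_cst.
Qed.

Lemma is_Cn_kernel_slope (P : E -> 'M[R]_n) :
  (forall x, U x -> pivotP F (P x) \in unitmx) ->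
  is_Cn j U P -> is_Cn j U (fun x => kernel_slope F (P x)).
Proof.
move=> uP CP; apply: (is_Cn_linear_mx dsubmx); apply: is_Cn_mulmx => //.
  exact/is_Cn_invmx/is_Cn_pivotP.
by apply/is_Cn_mulmxr/is_Cn_mulmxl/is_CnB => //; apply: is_Cn_cst.
Qed.

Lemma is_Cn_param (Y : E -> 'M[R]_(m, n)) (Z : E -> 'M[R]_(u, p))
    (W : E -> 'M[R]_(p, q)) :
  (forall x, U x -> pivot F (Y x) \in unitmx) ->
  is_Cn j U Y -> is_Cn j U Z -> is_Cn j U W ->
  is_Cn j U (fun x => param F (Y x) (Z x) (W x)).
Proof.
move=> uY CY CZ CW.
have CS : is_Cn j U (fun x => slope_rows F (W x)).
  by apply: is_CnD => //; [exact: is_Cn_cst|exact: is_Cn_mulmxr].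
have CL : is_Cn j U (fun x => coker_rows F (Y x) (W x)).
  apply: is_Cn_col_mx => //; apply: is_Cn_mulmx => //; last exact: is_Cn_mulmxl.
  exact/is_Cn_invmx/is_Cn_pivot.
apply: is_Cn_pair => //.
  by apply: is_CnD => //; apply: is_Cn_mulmx => //; apply: is_Cn_mulmxl.
apply: is_CnB; first exact: is_Cn_cst.
apply: is_Cn_mulmx => //; apply: is_Cn_mulmx => //; first exact: is_Cn_trmx.
apply: is_Cn_invmx => //; last by apply: is_Cn_mulmx => //; apply: is_Cn_trmx.
by move=> x Ux; apply/unitmx_gram/coker_rows_free/uY.
Qed.

End SmoothCoordinates.

Lemma open_pivot (R : realType) m n s u p q (F : block_frame R m n s u p q) :
  open [set X | pivot F X \in unitmx].
Proof.
rewrite -[X in open X]setTI.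
apply: (is_Cn_open_preimage (j := 0) (f := pivot F) openT (@open_unitmx R s)).
exact: (is_Cn_pivot openT F (is_Cn_id 0 _)).
Qed.

Lemma open_pivotP (R : realType) m n s u p q (F : block_frame R m n s u p q) :
  open [set P | pivotP F P \in unitmx].
Proof.
rewrite -[X in open X]setTI.
apply: (is_Cn_open_preimage (j := 0) (f := pivotP F) openT (@open_unitmx R (s + p))).
exact: (is_Cn_pivotP openT F (is_Cn_id 0 _)).
Qed.

Lemma coord_sliceP (R : realType) a b (v : 'rV[R]_(a + b)) :
  coord_slice R (a + b) a v <-> rsubmx v = 0.
Proof.
split=> [sv|v0 i].
  by apply/rowP => i; rewrite !mxE; apply: sv; rewrite /= leq_addr.
case: (split_ordP i) => l ->; first by rewrite /= leqNgt ltn_ord.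
by move/rowP/(_ l): v0; rewrite !mxE.
Qed.

Lemma is_Ck_C0 (R : realType) (V W : normedModType R) k (U : set V) (f : V -> W) :
  is_Ck k U f -> is_Cn 0 U f.
Proof.
case: k => [j|] /=; last by move/(_ 0%N).
exact: is_Cn_continuous.
Qed.

(** * Adapted charts built from a chart of the rank-s matrices *)

Section DesingularizationCharts.
Context {R : realType} {m n s u p q : nat} {F : block_frame R m n s u p q}.

Definition coord_dom : set ('M[R]_(m, n) * 'M[R]_n)%type :=
  [set Z | pivot F Z.1 \in unitmx /\ pivotP F Z.2 \in unitmx].

Lemma open_coord_dom : open coord_dom.
Proof.
have o1 := is_Cn_open_preimage openT (open_pivot (F := F))
  (is_Cn_fst openT (is_Cn_id (V := ('M[R]_(m, n) * 'M[R]_n)%type) 0 setT)).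
have o2 := is_Cn_open_preimage openT (open_pivotP (F := F))
  (is_Cn_snd openT (is_Cn_id (V := ('M[R]_(m, n) * 'M[R]_n)%type) 0 setT)).
by have := openI o1 o2; rewrite !setTI.
Qed.

Section Chart.
Context {k : option nat} {S : set 'M[R]_(m, n)} {d e : nat}.
Context {US : set 'M[R]_(m, n)} {VS : set 'rV[R]_(d + e)}.
Context {fS : 'M[R]_(m, n) -> 'rV[R]_(d + e)} {gS : 'rV[R]_(d + e) -> 'M[R]_(m, n)}.
Context (spn : (s + p <= n)%N) (SR : S `<=` fixed_rank R m n s).
Context (oUS : open US) (oVS : open VS) (CfS : is_Ck k US fS) (CgS : is_Ck k VS gS).
Context (gS_im : gS @` VS = US `&` fixed_rank R m n s).
Context (fgS : forall y, VS y -> fS (gS y) = y).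
Context (gS_slice : gS @` (VS `&` coord_slice R (d + e) d) = US `&` S).

(** The first d + p q coordinates hold those along S and the entries of W; the last e + u p hold
    those transverse to S and the entries of Z, and vanish exactly on the preimage of S. *)
Local Notation D := ((d + p * q) + (e + u * p))%N.

Let chart_dom : set ('M[R]_(m, n) * 'M[R]_n)%type :=
  coord_dom `&` (fun Z => rank_part F Z.1) @^-1` US.

Let yS (v : 'rV[R]_D) : 'rV[R]_(d + e) :=
  row_mx (lsubmx (lsubmx v)) (lsubmx (rsubmx v)).
Let yZ (v : 'rV[R]_D) : 'M[R]_(u, p) := vec_mx (rsubmx (rsubmx v)).
Let yW (v : 'rV[R]_D) : 'M[R]_(p, q) := vec_mx (rsubmx (lsubmx v)).

Let chart (Z : 'M[R]_(m, n) * 'M[R]_n) : 'rV[R]_D :=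
  row_mx (row_mx (lsubmx (fS (rank_part F Z.1))) (mxvec (kernel_slope F Z.2)))
         (row_mx (rsubmx (fS (rank_part F Z.1))) (mxvec (excess F Z.1))).

Let chart_inv (v : 'rV[R]_D) := param F (gS (yS v)) (yZ v) (yW v).

(** [img] is built in two stages: [chart_inv] must be known to be continuous on the open set
    [pre_img] before the condition on the projector can be pulled back through it. *)
Let pre_img : set 'rV[R]_D :=
  (yS @^-1` VS) `&` (gS \o yS) @^-1` [set X | pivot F X \in unitmx].

Let img : set 'rV[R]_D :=
  pre_img `&` (fun v => (chart_inv v).2) @^-1` [set P | pivotP F P \in unitmx].

Let yS_Cn j : is_Cn j setT yS.
Proof.
rewrite /yS; apply: (is_Cn_row_mx openT).
  apply: (is_Cn_linear_mx openT lsubmx); apply: (is_Cn_linear_mx openT lsubmx).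
  exact: is_Cn_id.
apply: (is_Cn_linear_mx openT lsubmx); apply: (is_Cn_linear_mx openT rsubmx).
exact: is_Cn_id.
Qed.

Let yZ_Cn j : is_Cn j setT yZ.
Proof.
apply: (is_Cn_linear_mx openT vec_mx); apply: (is_Cn_linear_mx openT rsubmx).
by apply: (is_Cn_linear_mx openT rsubmx); apply: is_Cn_id.
Qed.

Let yW_Cn j : is_Cn j setT yW.
Proof.
apply: (is_Cn_linear_mx openT vec_mx); apply: (is_Cn_linear_mx openT rsubmx).
by apply: (is_Cn_linear_mx openT lsubmx); apply: is_Cn_id.
Qed.

Let open_chart_dom : open chart_dom.
Proof.
apply: (is_Cn_open_preimage (j := 0) open_coord_dom oUS).
apply: (is_Cn_rank_part open_coord_dom); first by move=> Z [].
exact: is_Cn_fst open_coord_dom (is_Cn_id _ _).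
Qed.

Let open_yS : open (yS @^-1` VS).
Proof.
rewrite -[X in open X]setTI.
exact: (is_Cn_open_preimage (j := 0) openT oVS (yS_Cn 0)).
Qed.

Let gS_Cn j (U : set 'rV[R]_D) :
  open U -> U `<=` yS @^-1` VS -> is_Cn j VS gS -> is_Cn j U (gS \o yS).
Proof.
move=> oU UV Cg; apply: (is_Cn_comp (O := VS)) => //.
- exact: finite_coords_mx.
- exact: finite_coords_mx.
- exact: is_Cn_subset (@subsetT _ U) (yS_Cn j).
Qed.

Let open_pre_img : open pre_img.
Proof.
apply: (is_Cn_open_preimage (j := 0) open_yS (open_pivot (F := F))).
by apply: gS_Cn => //; apply: is_Ck_C0 CgS.
Qed.

Let chart_inv_Cn j (U : set 'rV[R]_D) :
  open U -> U `<=` pre_img -> is_Cn j VS gS -> is_Cn j U chart_inv.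
Proof.
move=> oU UV Cg; apply: (is_Cn_param oU).
- by move=> v /UV[].
- by apply: gS_Cn => // v /UV[].
- exact: is_Cn_subset (@subsetT _ U) (yZ_Cn j).
- exact: is_Cn_subset (@subsetT _ U) (yW_Cn j).
Qed.

Let open_img : open img.
Proof.
apply: (is_Cn_open_preimage (j := 0) open_pre_img (open_pivotP (F := F))).
apply: (is_Cn_snd open_pre_img); apply: chart_inv_Cn => //.
exact: is_Ck_C0 CgS.
Qed.

Let chart_Cn j : is_Cn j US fS -> is_Cn j chart_dom chart.
Proof.
move=> Cf; have o := open_chart_dom.
have CX : is_Cn j chart_dom fst by apply: is_Cn_fst (is_Cn_id _ _).
have CP : is_Cn j chart_dom snd by apply: is_Cn_snd (is_Cn_id _ _).
have CR : is_Cn j chart_dom (fun Z => rank_part F Z.1).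
  by apply: is_Cn_rank_part => // Z [[]].
have Cy : is_Cn j chart_dom (fun Z => fS (rank_part F Z.1)).
  apply: (is_Cn_comp (O := US) (f := fun Z => rank_part F Z.1)) => //.
  - exact: finite_coords_mx.
  - exact: finite_coords_mx.
  - by move=> Z [].
apply: is_Cn_row_mx => //; apply: is_Cn_row_mx => //.
- exact: (is_Cn_linear_mx o lsubmx).
- apply: (is_Cn_linear_mx o mxvec).
  by apply: is_Cn_kernel_slope => // Z [[]].
- exact: (is_Cn_linear_mx o rsubmx).
- apply: (is_Cn_linear_mx o mxvec).
  by apply: is_Cn_excess => // Z [[]].
Qed.

Let gS_dom y : VS y -> US (gS y) /\ \rank (gS y) = s.
Proof.
by move=> Vy; have : (gS @` VS) (gS y); [exists y|rewrite gS_im].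
Qed.

Let chart_inv_mem v : img v ->
  [/\ chart_dom (chart_inv v), desing R m n (s + p) (chart_inv v) &
      chart (chart_inv v) = v].
Proof.
move=> [[Vy uy] uP]; have [Uy ry] := gS_dom Vy.
have rp : rank_part F (chart_inv v).1 = gS (yS v) by apply: rank_part_param.
split.
- split; last by rewrite /preimage /= -/(chart_inv v) rp.
  by split; [rewrite pivot_param|].
- exact: param_desing.
rewrite /chart rp fgS // kernel_slope_param // excess_param //.
by rewrite row_mxKl row_mxKr !vec_mxK !hsubmxK.
Qed.

Let chart_invK Z : chart_dom Z -> desing R m n (s + p) Z ->
  exists v, [/\ img v, chart_inv v = Z, gS (yS v) = rank_part F Z.1,
    VS (yS v) & yZ v = excess F Z.1].
Proof.
move=> [[uX uP] UX] dZ.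
have : (gS @` VS) (rank_part F Z.1).
  by rewrite gS_im; split=> //; apply: mxrank_rank_part.
move=> [y Vy gy].
exists (row_mx (row_mx (lsubmx y) (mxvec (kernel_slope F Z.2)))
         (row_mx (rsubmx y) (mxvec (excess F Z.1)))).
set v := row_mx _ _.
have yv : yS v = y by rewrite /yS /v !row_mxKl row_mxKr row_mxKl hsubmxK.
have Wv : yW v = kernel_slope F Z.2 by rewrite /yW /v row_mxKl row_mxKr mxvecK.
have Zv : yZ v = excess F Z.1 by rewrite /yZ /v !row_mxKr mxvecK.
have ZE : chart_inv v = Z.
  rewrite /chart_inv yv gy Wv Zv.
  by case: Z uX uP dZ {UX gy v yv Wv Zv} => X P uX uP dZ; apply: param_coords.
rewrite yv; split=> //; split; last by rewrite /preimage /mkset ZE.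
by split; rewrite /preimage /= yv ?gy // pivot_rank_part.
Qed.

Lemma slice_chart_desing X P : US X -> pivot F X \in unitmx ->
  pivotP F P \in unitmx -> phi_preimage (s + p) S (X, P) ->
  slice_chart_at k (desing R m n (s + p)) D (phi_preimage (s + p) S)
    (d + p * q)%N (X, P).
Proof.
move=> UX uX uP [dXP SX].
exists chart_dom, img, chart, chart_inv; split.
- split=> //; split; first by [].
  by rewrite /preimage /= rank_part_id //; apply: SR.
- exact: open_img.
- split; apply/is_CkP => j kj.
    by apply: chart_Cn; move/is_CkP: CfS; apply.
  apply: (chart_inv_Cn open_img); first by move=> v [].
  by move/is_CkP: CgS; apply.
- split; last by move=> v /chart_inv_mem[].
  apply/seteqP; split=> [_ [v /chart_inv_mem[? ? _] <-] //|Z [UZ dZ]].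
  by have [v [? ? _ _ _]] := chart_invK UZ dZ; exists v.
apply/seteqP; split=> [_ [v [iv /coord_sliceP sv] <-]|Z [UZ [dZ SZ]]].
  have [? ? _] := chart_inv_mem iv; split=> //; split=> //.
  (* With Z = 0 the first component of [chart_inv v] is [gS (yS v)], so membership in S is decided
     by the given chart. *)
  have Zv0 : yZ v = 0 by rewrite /yZ sv !linear0.
  rewrite /preimage /mkset /phi /chart_inv Zv0 param0.
  have : (gS @` (VS `&` coord_slice R (d + e) d)) (gS (yS v)).
    exists (yS v) => //; split; first by case: iv => [[]].
    by apply/coord_sliceP; rewrite /yS row_mxKr sv linear0.
  by rewrite gS_slice => -[].
have [v [iv vZ gv Vv Zv]] := chart_invK UZ dZ; exists v => //; split=> //.
have [[uZ _] UZ'] := UZ; have rZ := SR SZ.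
have : (gS @` (VS `&` coord_slice R (d + e) d)) (gS (yS v)).
  by rewrite gS_slice gv rank_part_id //; split=> //; rewrite -(rank_part_id uZ rZ).
move=> [y [Vy /coord_sliceP sy] gy].
(* [gS] is injective on [VS], so the slice point [y] provided by S is [yS v] itself. *)
have yE : yS v = y by rewrite -(fgS Vv) -gy fgS.
apply/coord_sliceP; rewrite -[rsubmx v]hsubmxK.
have -> : lsubmx (rsubmx v) = 0 by rewrite -sy -yE /yS row_mxKr.
have -> : rsubmx (rsubmx v) = 0.
  by apply: (can_inj vec_mxK); rewrite -/(yZ v) Zv excess0 // linear0.
exact: row_mx0.
Qed.

End Chart.
End DesingularizationCharts.

(** * Tangent spaces *)

Lemma derive1_diff_comp (R : realType) (V W : normedModType R) (c : R -> V)
    (g : V -> W) (t : R) :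
  differentiable c t -> differentiable g (c t) ->
  derive1 (g \o c) t = 'd g (c t) (derive1 c t).
Proof.
move=> dc dg; rewrite !derive1E' //; last exact: differentiable_comp.
exact: (congr1 (@^~ 1) (diff_comp dc dg)).
Qed.

Section TangentSpace.
Context {R : realType} {m n s u p q : nat}.
Local Notation ambient := ('M[R]_(m, n) * 'M[R]_n)%type.

Lemma finite_coords_ambient : finite_coords ambient.
Proof. by apply: finite_coords_prod; apply: finite_coords_mx. Qed.

Definition desing_retract (F : block_frame R m n s u p q) (Z : ambient) : ambient :=
  param F (rank_part F Z.1) (excess F Z.1) (kernel_slope F Z.2).

Variable F : block_frame R m n s u p q.
Local Notation rho := (desing_retract F).
Local Notation dom := (@coord_dom R m n s u p q F).

Lemma desing_retract_Cn j : is_Cn j dom rho.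
Proof.
have o := @open_coord_dom R m n s u p q F.
have C1 : is_Cn j dom fst by apply: is_Cn_fst (is_Cn_id _ _).
have C2 : is_Cn j dom snd by apply: is_Cn_snd (is_Cn_id _ _).
apply: (is_Cn_param o) => [Z [uX _]|||]; first by rewrite pivot_rank_part.
- by apply: is_Cn_rank_part => // Z [].
- by apply: is_Cn_excess => // Z [].
- by apply: is_Cn_kernel_slope => // Z [].
Qed.

Lemma desing_retract_desing Z : dom Z -> desing R m n (s + p) (rho Z).
Proof.
move=> [uX _]; apply: param_desing; first by rewrite pivot_rank_part.
exact: mxrank_rank_part.
Qed.

(** At rank s the excess vanishes, so the retraction moves only the projector. *)
Lemma desing_retract_fst Z : dom Z -> \rank Z.1 = s -> (rho Z).1 = Z.1.
Proof.
by move=> [uX _] rX; rewrite /desing_retract excess0 // param0 rank_part_id.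
Qed.

Lemma desing_retract_id Z : (s + p <= n)%N -> dom Z ->
  desing R m n (s + p) Z -> rho Z = Z.
Proof.
by case: Z => X P spn [uX uP] dZ; apply: param_coords.
Qed.

End TangentSpace.

Lemma open_norm_lt (R : realType) (e : R) : open [set t : R | `|t| < e].
Proof.
rewrite (_ : [set _ | _] = ball (0 : R) e); first exact: ball_open.
by apply/seteqP; split=> t; rewrite -ball_normE /= sub0r normrN.
Qed.

Lemma open_norm_lt_sub (R : realType) (O : set R) : open O -> O 0 ->
  exists e : R, 0 < e /\ [set t | `|t| < e] `<=` O.
Proof.
move=> oO O0; have /nbhs_ballP[e e0 eO] := open_nbhs_nbhs (conj oO O0).
by exists e; split=> // t te; apply: eO; rewrite -ball_normE /= sub0r normrN.
Qed.

Lemma tangent_phi_preimage (R : realType) m n s u p q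
    (S : set 'M[R]_(m, n)) (X : 'M[R]_(m, n)) (P : 'M[R]_n) :
  (s + u = m)%N -> (s + p + q = n)%N -> S `<=` fixed_rank R m n s ->
  phi_preimage (s + p) S (X, P) ->
  tangent_space (phi_preimage (s + p) S) (X, P) =
  [set V | tangent_space (desing R m n (s + p)) (X, P) V /\
           tangent_space S X V.1].
Proof.
move=> mE nE SR [dXP SX]; apply/seteqP; split=> [V [c [e [e0 Cc Mc c0 cV]]]|].
  have dc : differentiable c 0 by case: Cc => + _; apply; rewrite /= normr0.
  split; first by exists c, e; split=> // t /Mc[].
  exists (fst \o c), e; split=> //.
  - exact: is_Cn_fst (open_norm_lt (e := e)) Cc.
  - by move=> t /Mc[].
  - by rewrite /= c0.
  have cf : continuous (@fst 'M[R]_(m, n) 'M[R]_n) by move=> x; apply: cvg_fst.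
  rewrite derive1_diff_comp //; last exact: linear_differentiable.
  by rewrite diff_lin // cV.
move=> V [[c1 [e1 [e10 C1 M1 c10 c1V]]] [c2 [e2 [e20 C2 M2 c20 c2V]]]].
have [F [uX uP]] := block_frame_exists mE nE (SR _ SX) dXP.
pose rho := desing_retract F; pose dom := @coord_dom R m n s u p q F.
have odom : open dom := @open_coord_dom R m n s u p q F.
have domXP : dom (X, P) by [].
(* [h] has velocity V at 0, but its two components come from different curves and need not satisfy X
   P = 0; the retraction [rho] repairs this. *)
pose h t := (c2 t, (c1 t).2).
pose B := [set t : R | `|t| < e1] `&` [set t : R | `|t| < e2].
have oB : open B by apply: openI; apply: open_norm_lt.
have B1 : is_Cn 1 B c1 by apply: is_Cn_subset C1 => t [].
have B2 : is_Cn 1 B c2 by apply: is_Cn_subset C2 => t [].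
have Bh : is_Cn 1 B h by apply: is_Cn_pair => //; apply: is_Cn_snd.
(* The time interval must keep both [c1] and [h] in the domain of [rho]. *)
have oO : open ((B `&` c1 @^-1` dom) `&` (B `&` h @^-1` dom)).
  by apply: openI; [apply: (is_Cn_open_preimage oB odom B1)|
                    apply: (is_Cn_open_preimage oB odom Bh)].
have B0 : B 0 by rewrite /B /= normr0.
have h0 : h 0 = (X, P) by rewrite /h c10 c20.
have [|e [e_gt0 eO]] := open_norm_lt_sub oO.
  by rewrite /preimage /= h0 c10.
have dc1 : differentiable c1 0 by case: B1 => + _; apply.
have dc2 : differentiable c2 0 by case: B2 => + _; apply.
have dh : differentiable h 0 by case: Bh => + _; apply.
have drho : differentiable rho (X, P).
  by case: (desing_retract_Cn F 1) => + _; apply.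
have spn : (s + p <= n)%N by rewrite -nE leq_addr.
exists (rho \o h), e; split=> //.
- apply: (is_Cn_comp (O := dom)).
  + exact: finite_coords_ambient.
  + exact: finite_coords_ambient.
  + exact: open_norm_lt.
  + exact: odom.
  + by move=> t /eO[_ []].
  + by apply: is_Cn_subset Bh => t /eO[[]].
  + exact: desing_retract_Cn.
- move=> t te; have [[[_ te2] _] [_ ht]] := eO t te.
  split; first exact: desing_retract_desing.
  have E : ((rho \o h) t).1 = c2 t.
    by apply: (desing_retract_fst ht); apply: SR; apply: M2.
  by rewrite /preimage /mkset /phi E; apply: M2.
- by rewrite /= h0; apply: desing_retract_id.
have hV : derive1 h 0 = V.
  have cs : continuous (@snd 'M[R]_(m, n) 'M[R]_n) by move=> x; apply: cvg_snd.
  have ds : differentiable (snd \o c1) 0.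
    by apply: differentiable_comp => //; apply: linear_differentiable.
  rewrite derive1E' //; apply: etrans (congr1 (@^~ 1) (diff_pair dc2 ds)) _.
  have -> : 'd c2 0 1 = V.1 by rewrite -derive1E'.
  have -> : 'd (snd \o c1) 0 1 = V.2.
    rewrite -derive1E' // derive1_diff_comp //; last exact: linear_differentiable.
    by rewrite diff_lin // c1V.
  by case: (V).
(* [h] and [c1] share base point and velocity at 0, so by the chain rule their images under [rho] do
   too; and [rho] fixes the curve [c1] near 0. *)
have -> : derive1 (rho \o h) 0 = derive1 (rho \o c1) 0.
  have drh : differentiable rho (h 0) by rewrite h0.
  have drc : differentiable rho (c1 0) by rewrite c10.
  by rewrite (derive1_diff_comp dh drh) (derive1_diff_comp dc1 drc) h0 c10 hV c1V.
rewrite -c1V !derive1E; apply: near_eq_derive.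
have : nbhs (0 : R) [set t : R | `|t| < e].
  by apply: open_nbhs_nbhs; split; [exact: open_norm_lt|rewrite /= normr0].
apply: filterS => t te.
have [[[te1 _] ct] _] := eO t te.
by apply: desing_retract_id => //; apply: M1.
Qed.

Theorem proposition2p12 (R : realType) (m n r s : nat)
    (hr : (0 < r)%N) (hrmn : (r < minn m n)%N) (hs : (s <= r)%N)
    (k : option nat) (S : set 'M[R]_(m, n)) (d : nat)
    (hS : embedded_submanifold k (fixed_rank R m n s) ((m + n - s) * s)%N S d) :
  embedded_submanifold k (desing R m n r) ((m + n - r) * r)%N
    (phi_preimage r S) (d + (n - r) * (r - s))%N
  /\
  (forall (X : 'M[R]_(m, n)) (P : 'M[R]_n), phi_preimage r S (X, P) ->
     tangent_space (phi_preimage r S) (X, P) =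
     [set V | tangent_space (desing R m n r) (X, P) V /\
              tangent_space S X V.1]).
Proof.
case: hS => SR dD chartS.
(* The truncated differences r - s, n - r, m - s and the codimension of S become block sizes [p],
   [q], [u], [e], so that matrix types and dimensions are plain sums. *)
have [p rE] : exists p, r = (s + p)%N by exists (r - s)%N; rewrite subnKC.
subst r.
have [rm rn] : (s + p < m)%N /\ (s + p < n)%N.
  by apply/andP; rewrite -leq_min.
have [q nE] : exists q, (s + p + q = n)%N.
  by exists (n - (s + p))%N; rewrite subnKC // ltnW.
have [u mE] : exists u, (s + u = m)%N.
  by exists (m - s)%N; rewrite subnKC // (leq_trans (leq_addr p s)) // ltnW.
have [e D0E] : exists e, ((m + n - s) * s = d + e)%N.
  by exists ((m + n - s) * s - d)%N; rewrite subnKC.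
(* With these sizes the identity is (s + u + q)(s + p) = s (s + u + p + q) + p q + u p: W and Z add
   p q and u p to the dimension of the rank-s matrices. *)
have DE : ((m + n - (s + p)) * (s + p) = (d + p * q) + (e + u * p))%N.
  rewrite addnACA -D0E -mE -nE.
  have -> : (s + u + (s + p + q) - (s + p) = s + u + q)%N by lia.
  have -> : (s + u + (s + p + q) - s = s + u + p + q)%N by lia.
  lia.
have dE : (d + (n - (s + p)) * (s + p - s) = d + p * q)%N.
  by rewrite -{1}nE !addKn mulnC.
rewrite DE dE; rewrite D0E in chartS; split; last first.
  by move=> X P XP; apply: (tangent_phi_preimage mE nE SR XP).
split; [by move=> Z [] | exact: leq_addr |].
move=> [X P] [dXP SX].
have [F [uX uP]] := block_frame_exists mE nE (SR _ SX) dXP.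
have [US [VS [fS [gS [[oU UX] oV [Cf Cg] [gim fg] gsl]]]]] := chartS X SX.
by apply: (slice_chart_desing (F := F) (ltnW rn) SR oU oV Cf Cg gim fg gsl).
Qed.
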